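(* Let $S_e=S_e(A,\rho,b,\lambda)$ be the extended solution set of the sGMC model, let $\mathscr{P}=\mathbb{R}^{m\times n}\times[0,1)\times\mathbb{R}^{2m}\times\mathbb{R}_{++}$, and define: - $\beta_e:=Cw$ for $w\in S_e$, where $C=\mathrm{blkdiag}(A,\sqrt{\rho}A)$ (the common value over all $w\in S_e$); - $\gamma_e:=\|w\|_1$ for $w\in S_e$ (the common value over all $w\in S_e$); - for a given $\bar w\in\mathbb{R}^{2n}$, $P_{S_e}(\bar w)$ is the unique Euclidean projection of $\bar w$ onto $S_e$; in particular $P_{S_e}(0)=w_\star$ is the minimum $\ell_2$-norm extended solution. Then: (a) As mappings of $(A,\rho,b,\lambda)$: $S_e$ is outer semicontinuous relative to $\mathscr{P}$, and $\beta_e$ and $\gamma_e$ are continuous relative to $\mathscr{P}$. (b) Fix $(A,\rho)\in\mathbb{R}^{m\times n}\times[0,1)$. As mappings of $(b,\lambda)$: $S_e$ is continuous (as a set-valued mapping) relative to $\mathbb{R}^{2m}\times\mathbb{R}_{++}$, and for every given $\bar w\in\mathbb{R}^{2n}$, $P_{S_e}(\bar w)$ is continuous relative to $\mathbb{R}^{2m}\times\mathbb{R}_{++}$; in particular $w_\star$ is continuous relative to $\mathbb{R}^{2m}\times\mathbb{R}_{++}$.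
   Context: Here $\mathbb{R}_{++}=(0,\infty)$, $m,n$ are positive integers, and $b=(y^\top,r^\top)^\top$ with $y,r\in\mathbb{R}^m$. The sGMC model. Define, for $x,z\in\mathbb{R}^n$, $$G(x,z)=\tfrac12\|y-Ax\|_2^2+\lambda\|x\|_1-\lambda\|z\|_1-\tfrac{\rho}{2}\|Ax-Az\|_2^2+\sqrt{\rho}\,r^\top Az .$$ The extended solution set $S_e\subset\mathbb{R}^{2n}$ is the set of $w=(x^\top,z^\top)^\top$ such that $(x,z)$ is a saddle point of $\min_x\max_z G$, i.e. $G(x,z')\le G(x,z)\le G(x',z)$ for all $x',z'\in\mathbb{R}^n$. It is known that $S_e$ is nonempty, closed, convex and bounded, and that $Cw$ and $\|w\|_1$ do not depend on the choice of $w\in S_e$. Set-valued continuity. For sets $S_k\subset\mathbb{R}^N$ ($k\in\mathbb{N}$), $\limsup_kS_k$ is the set of all cluster points of sequences $(x_k)$ with $x_k\in S_k$ for all $k$, and $\liminf_kS_k$ is the set of all limits of convergent sequences $(x_k)$ with $x_k\in S_k$ for all $k$. A set-valued mapping $\mathcal{M}:D\rightrightarrows\mathbb{R}^N$, with $D$ a subset of a Euclidean space, is outer semicontinuous (resp. inner semicontinuous) at $\bar\theta\in D$ relative to $D$ if for every sequence $(\theta_k)\subset D$ with $\theta_k\to\bar\theta$, $\limsup_k\mathcal{M}(\theta_k)\subset\mathcal{M}(\bar\theta)$ (resp. $\liminf_k\mathcal{M}(\theta_k)\supset\mathcal{M}(\bar\theta)$). It is continuous at $\bar\theta$ relative to $D$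 if it is both. ''Relative to $D$'' without a point means at every point of $D$. *)

(* Defs.v *)
From mathcomp Require Import all_boot all_order all_algebra.
From mathcomp Require Import all_classical all_reals all_analysis.

Set Implicit Arguments.
Unset Strict Implicit.
Unset Printing Implicit Defensive.

Import Order.TTheory GRing.Theory Num.Theory.
Import numFieldNormedType.Exports.
Local Open Scope classical_set_scope.
Local Open Scope ring_scope.

Section SetValuedMappings.
Variables T V : topologicalType.

Definition outer_limit (S : nat -> set V) : set V :=
  [set x | exists u : nat -> V, (forall k, S k (u k)) /\ cluster (u @ \oo) x].

Definition inner_limit (S : nat -> set V) : set V :=
  [set x | exists u : nat -> V, (forall k, S k (u k)) /\ u @ \oo --> x].

Definition osc_at (D : set T) (M : T -> set V) (t : T) : Prop :=
  forall s : nat -> T, (forall k, D (s k)) -> s @ \oo --> t ->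
    outer_limit (fun k => M (s k)) `<=` M t.

Definition isc_at (D : set T) (M : T -> set V) (t : T) : Prop :=
  forall s : nat -> T, (forall k, D (s k)) -> s @ \oo --> t ->
    M t `<=` inner_limit (fun k => M (s k)).

Definition outer_semicontinuous_on (D : set T) (M : T -> set V) : Prop :=
  forall t, D t -> osc_at D M t.

Definition set_continuous_on (D : set T) (M : T -> set V) : Prop :=
  forall t, D t -> osc_at D M t /\ isc_at D M t.

End SetValuedMappings.

Section Norms.
Variable R : realType.

(* The norm carried by the matrix types is the sup norm; the topology on
   ['cV[R]_N] used below is the product one, i.e. the Euclidean one. *)
Definition l1norm (N : nat) (v : 'cV[R]_N) : R := \sum_i `|v i ord0|.

Definition l2norm (N : nat) (v : 'cV[R]_N) : R :=
  Num.sqrt (\sum_i v i ord0 ^+ 2).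

(* An [l2norm]-nearest point of [S] to [w]; [0] if there is none. It is unique
   when [S] is nonempty, closed and convex. *)
Definition proj (N : nat) (S : set 'cV[R]_N) (w : 'cV[R]_N) : 'cV[R]_N :=
  xget 0 [set p | S p /\ forall q, S q -> l2norm (w - p) <= l2norm (w - q)].

End Norms.

Section SGMC.
Variables (R : realType) (m n : nat).

(* The parameters are [(A, rho, b, lam)] where [b] stacks [y] over [r]. *)
Local Notation param := ('M[R]_(m, n) * R * 'cV[R]_(m + m) * R)%type.

Definition paramset : set param :=
  [set t | let: (A, rho, b, lam) := t in 0 <= rho < 1 /\ 0 < lam].

Definition Gobj (A : 'M[R]_(m, n)) (rho : R) (y r : 'cV[R]_m) (lam : R)
    (x z : 'cV[R]_n) : R :=
  2^-1 * l2norm (y - A *m x) ^+ 2 + lam * l1norm x - lam * l1norm z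
  - rho / 2 * l2norm (A *m x - A *m z) ^+ 2
  + Num.sqrt rho * (r^T *m A *m z) ord0 ord0.

Definition is_saddle (F : 'cV[R]_n -> 'cV[R]_n -> R) (x z : 'cV[R]_n) : Prop :=
  forall x' z', F x z' <= F x z /\ F x z <= F x' z.

Definition Se (t : param) : set 'cV[R]_(n + n) :=
  let: (A, rho, b, lam) := t in
  [set w | is_saddle (Gobj A rho (usubmx b) (dsubmx b) lam) (usubmx w) (dsubmx w)].

Definition Cmx (A : 'M[R]_(m, n)) (rho : R) : 'M[R]_(m + m, n + n) :=
  block_mx A 0 0 (Num.sqrt rho *: A).

(* [C w] and [l1norm w] are constant on the nonempty set [Se t] for [t] in
   [paramset], so the choice made by [xget] is immaterial there. *)
Definition beta_e (t : param) : 'cV[R]_(m + m) :=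
  let: (A, rho, b, lam) := t in
  xget 0 [set Cmx A rho *m w | w in Se t].

Definition gamma_e (t : param) : R :=
  xget 0 [set l1norm w | w in Se t].

Definition PSe (wbar : 'cV[R]_(n + n))
    (t : param) : 'cV[R]_(n + n) :=
  proj (Se t) wbar.

Definition w_star (t : param) :
  'cV[R]_(n + n) := PSe 0 t.

End SGMC.

(* Main.v *)
Require Import Defs.
From mathcomp Require Import all_boot all_order all_algebra.
From mathcomp Require Import all_classical all_reals all_analysis.
From mathcomp Require Import ring lra.
Import Order.TTheory GRing.Theory Num.Theory.
Import numFieldNormedType.Exports.
Local Open Scope classical_set_scope.
Local Open Scope ring_scope.

Set Implicit Arguments.
Unset Strict Implicit.
Unset Printing Implicit Defensive.

(** The saddle points of the sGMC objective are the solutions of one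
    variational inequality.  With [C = blkdiag(A, sqrt rho A)] and
    [D = ((1 - rho) I, sqrt rho I; - sqrt rho I, I)], a vector [w] belongs to
    [Se] exactly when
      [<b - D C w, C (w' - w)> <= lam (|w'|_1 - |w|_1)] for all [w']
    ([Se_sol]).  The matrix [D] is not symmetric, but its symmetric part is
    [diag((1 - rho) I, I)], so [D] is strongly monotone with constant
    [1 - rho].  The set of solutions of such an inequality is called [sol]
    below, and everything follows from four of its properties.

    - It is nonempty ([sol_exists]): the step [v |-> v - tau (D v - b)] followed
      by a lasso fit is a contraction, and a fixed point of it is [C w] for a
      solution [w].
    - Strong monotonicity forces [C w] and [|w|_1] to be the same for all
      solutions, and conversely any [w'] with [C w' = C w] and
      [|w'|_1 <= |w|_1] is again a solution ([sol_stable]).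
    - Solutions are bounded by [|b|^2 / (4 (1 - rho) lam)] in the l1 norm, hence
      locally uniformly in the parameters.
    - The inequality passes to limits jointly in the parameters and in [w]
      ([sol_outer]).

    The last two give part (a): outer semicontinuity is closedness of the graph,
    and a function of the parameters that is obtained by evaluating a continuous
    function at any solution is continuous by compactness
    ([outer_approx_cvg]).

    For part (b) only inner semicontinuity is missing ([sol_inner]).  Let [q]
    solve the limit problem, and let solutions [y] of nearby problems be close
    to some limit solution [x].  Move [y] to [y + t (q - x)] with [t < 1].  As
    [C] is fixed and [C q = C x], the fit [C y] does not change; as the l1 norm
    is polyhedral and [|q|_1 = |x|_1], the l1 norm does not increase once [y] is
    close enough to [x] ([l1norm_shift_near]).  So the moved point is a solution
    of the nearby problem, and it is close to [q] when [t] is close to 1.  A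
    compactness argument removes the dependence on [x].  Outer and inner
    semicontinuity together make the projection continuous ([proj_cvg]), and the
    projection of a limit solution [q] onto the nearby solution sets is the
    sequence that inner semicontinuity asks for. *)

(** * Dot product, l1 norm and first-order conditions *)

Section DotProduct.
Variables (R : realType) (N : nat).
Implicit Types (u v w : 'cV[R]_N) (a : R).

Definition dot u v : R := \sum_i u i ord0 * v i ord0.

Lemma dotC u v : dot u v = dot v u.
Proof. by apply: eq_bigr => i _; rewrite mulrC. Qed.

Lemma dotDl u v w : dot (u + v) w = dot u w + dot v w.
Proof. by rewrite -big_split; apply: eq_bigr => i _; rewrite mxE mulrDl. Qed.

Lemma dotZl a u v : dot (a *: u) v = a * dot u v.
Proof. by rewrite mulr_sumr; apply: eq_bigr => i _; rewrite mxE mulrA. Qed.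

Lemma dotNl u v : dot (- u) v = - dot u v.
Proof. by rewrite -scaleN1r dotZl mulN1r. Qed.

Lemma dotDr u v w : dot u (v + w) = dot u v + dot u w.
Proof. by rewrite ![dot u _]dotC dotDl. Qed.

Lemma dotZr a u v : dot u (a *: v) = a * dot u v.
Proof. by rewrite ![dot u _]dotC dotZl. Qed.

Lemma dotNr u v : dot u (- v) = - dot u v.
Proof. by rewrite ![dot u _]dotC dotNl. Qed.

Lemma dot0l u : dot 0 u = 0.
Proof. by rewrite -(scale0r 0) dotZl mul0r. Qed.

Definition dotE := (dotDl, dotDr, dotNl, dotNr, dotZl, dotZr).

Lemma dot_ge0 u : 0 <= dot u u.
Proof. by apply: sumr_ge0 => i _; rewrite -expr2; exact: sqr_ge0. Qed.

Lemma dot_eq0 u : (dot u u == 0) = (u == 0).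
Proof.
rewrite psumr_eq0 => [|i _]; last by rewrite -expr2 sqr_ge0.
apply/allP/eqP => [u0|-> i _]; last by rewrite mxE mulr0 eqxx.
apply/colP => i; rewrite mxE.
by have /= := u0 i (mem_index_enum i); rewrite -expr2 sqrf_eq0 => /eqP.
Qed.

Lemma dot_eq0P u : dot u u <= 0 -> u = 0.
Proof. by move=> u0; apply/eqP; rewrite -dot_eq0 eq_le u0 dot_ge0. Qed.

Lemma sqr_coord_le_dot u i : u i ord0 ^+ 2 <= dot u u.
Proof.
rewrite /dot (bigD1 i)//= expr2 lerDl; apply: sumr_ge0 => j _.
by rewrite -expr2 sqr_ge0.
Qed.

Lemma dot_Young u v : 2 * dot u v <= dot u u + dot v v.
Proof. by have := dot_ge0 (u - v); rewrite !dotE (dotC v u); lra. Qed.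

Lemma l2norm_sqr u : l2norm u ^+ 2 = dot u u.
Proof.
rewrite /l2norm sqr_sqrtr; first by apply: eq_bigr => i _; rewrite expr2.
by apply: sumr_ge0 => i _; rewrite sqr_ge0.
Qed.

Lemma l2norm_le u v : (l2norm u <= l2norm v) = (dot u u <= dot v v).
Proof. by rewrite -!l2norm_sqr ler_sqr ?nnegrE ?sqrtr_ge0. Qed.

Lemma l1norm0 : l1norm (0 : 'cV[R]_N) = 0.
Proof. by apply: big1 => i _; rewrite mxE normr0. Qed.

Lemma l1normD u v : l1norm (u + v) <= l1norm u + l1norm v.
Proof. by rewrite -big_split; apply: ler_sum => i _; rewrite mxE ler_normD. Qed.

Lemma l1normZ a u : l1norm (a *: u) = `|a| * l1norm u.
Proof. by rewrite mulr_sumr; apply: eq_bigr => i _; rewrite mxE normrM. Qed.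

Lemma l1norm_segment u v a : 0 <= a <= 1 ->
  l1norm (u + a *: (v - u)) <= l1norm u + a * (l1norm v - l1norm u).
Proof.
move=> /andP[a0 a1]; have -> : u + a *: (v - u) = (1 - a) *: u + a *: v.
  by rewrite scalerBr scalerBl scale1r addrCA addrC addrAC -addrA.
apply: le_trans (l1normD _ _) _.
by rewrite !l1normZ !ger0_norm ?subr_ge0//; lra.
Qed.

End DotProduct.

Lemma l1norm_col (R : realType) (p q : nat) (w : 'cV[R]_(p + q)) :
  l1norm w = l1norm (usubmx w) + l1norm (dsubmx w).
Proof.
by rewrite /l1norm big_split_ord; congr (_ + _); apply: eq_bigr => i _;
  rewrite mxE.
Qed.

Lemma dot_col (R : realType) (p q : nat) (u v : 'cV[R]_p) (u' v' : 'cV[R]_q) :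
  dot (col_mx u u') (col_mx v v') = dot u v + dot u' v'.
Proof.
by rewrite /dot big_split_ord; congr (_ + _); apply: eq_bigr => i _;
  rewrite ?col_mxEu ?col_mxEd.
Qed.

(** At small [t] the linear term decides the sign. *)
Lemma ge0_linear_part (R : realType) (a q : R) :
  (forall t, 0 < t <= 1 -> 0 <= t * a + t ^+ 2 * q) -> 0 <= a.
Proof.
move=> H; rewrite leNgt; apply/negP => a0.
have d0 : 0 < `|q| - a by rewrite -[ltLHS]addr0 ler_ltD ?oppr_gt0.
(* If [a < 0], this [t] satisfies [t |q| < - a], so the linear term wins. *)
pose t := - a / (`|q| - a).
have t0 : 0 < t by rewrite divr_gt0// oppr_gt0.
have t1 : t <= 1 by rewrite ler_pdivrMr// mul1r lerDr.
have /H : 0 < t <= 1 by rewrite t0.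
rewrite expr2 -mulrA -mulrDr pmulr_rge0// => aq.
have : t * q <= t * `|q| by rewrite ler_pM2l// ler_norm.
have : t * (`|q| - a) = - a by rewrite divfK// gt_eqF.
have : 0 < t * - a by rewrite mulr_gt0// oppr_gt0.
lra.
Qed.

(** First-order optimality for a convex quadratic plus a multiple of the l1 norm:
    [F] has quadratic part [Q] and gradient [- L] at [x].  Minimality along the
    segment from [x] to [x'], with the convexity of the l1 norm, yields the
    inequality; the converse only drops [Q >= 0].  It serves for the lasso and
    for both halves of the saddle-point condition. *)
Lemma l1_composite_minP (R : realType) (N : nat) (F L Q : 'cV[R]_N -> R)
    (lam : R) (x : 'cV[R]_N) :
  0 <= lam ->
  (forall v, 0 <= Q v) ->
  (forall t v, L (t *: v) = t * L v) -> (forall t v, Q (t *: v) = t ^+ 2 * Q v) ->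
  (forall x', F x' - F x = Q (x' - x) - L (x' - x) + lam * (l1norm x' - l1norm x)) ->
  (forall x', F x <= F x') <->
  (forall x', L (x' - x) <= lam * (l1norm x' - l1norm x)).
Proof.
move=> lam0 Q0 LZ QZ FE; split=> [xmin x'|xmin x']; last first.
  by rewrite -subr_ge0 FE; have := Q0 (x' - x); have := xmin x'; lra.
rewrite -subr_ge0; apply: (@ge0_linear_part _ _ (Q (x' - x))) => t /andP[t0 t1].
have := xmin (x + t *: (x' - x)).
rewrite -subr_ge0 FE [x + _ - x]addrAC subrr add0r LZ QZ.
have : l1norm (x + t *: (x' - x)) <= l1norm x + t * (l1norm x' - l1norm x).
  by apply: l1norm_segment; rewrite ltW.
move=> /(ler_wpM2l lam0); lra.
Qed.

(** * Limits of matrix expressions and compactness of l1 balls *)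

Section MatrixLimits.
Context {R : realType} {T : Type} {F : set_system T} {FF : Filter F}.

Lemma cvg_mx (p q : nat) (Mf : T -> 'M[R]_(p, q)) (M : 'M[R]_(p, q)) :
  (forall i j, Mf t i j @[t --> F] --> M i j) -> Mf @ F --> M.
Proof.
move=> cvM B [P PM sPB]; apply: (filterS (fun t => @sPB (Mf t))).
by apply: filter_forall => i; apply: filter_forall => j; apply: cvM; exact: PM.
Qed.

Lemma cvg_coord (p q : nat) (Mf : T -> 'M[R]_(p, q)) (M : 'M[R]_(p, q)) i j :
  Mf @ F --> M -> Mf t i j @[t --> F] --> M i j.
Proof.
by move=> cvM; exact: (cvg_comp _ _ cvM (@coord_continuous _ _ _ i j M)).
Qed.

Lemma cvg_sumr (I : finType) (f : T -> I -> R) (a : I -> R) :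
  (forall i, f t i @[t --> F] --> a i) ->
  \sum_i f t i @[t --> F] --> \sum_i a i.
Proof.
move=> cvf; apply: (cvg_big _ (Ff := fun i t => f t i)) => //.
exact: add_continuous.
Qed.

Lemma cvg_mulmx (p q r : nat) (Mf : T -> 'M[R]_(p, q)) (M : 'M[R]_(p, q))
    (Nf : T -> 'M[R]_(q, r)) (N : 'M[R]_(q, r)) :
  Mf @ F --> M -> Nf @ F --> N -> Mf t *m Nf t @[t --> F] --> M *m N.
Proof.
move=> cvM cvN; apply: cvg_mx => i j; rewrite mxE; under eq_fun do rewrite mxE.
by apply: cvg_sumr => k; apply: cvgM; exact: cvg_coord.
Qed.

Lemma cvg_dot (p : nat) (uf vf : T -> 'cV[R]_p) (u v : 'cV[R]_p) :
  uf @ F --> u -> vf @ F --> v -> dot (uf t) (vf t) @[t --> F] --> dot u v.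
Proof.
by move=> cvu cvv; apply: cvg_sumr => k; apply: cvgM; exact: cvg_coord.
Qed.

Lemma cvg_l1norm (p : nat) (uf : T -> 'cV[R]_p) (u : 'cV[R]_p) :
  uf @ F --> u -> l1norm (uf t) @[t --> F] --> l1norm u.
Proof.
by move=> cvu; apply: cvg_sumr => k; apply: cvg_norm; exact: cvg_coord.
Qed.

Lemma cvg_block_mx (p1 p2 q1 q2 : nat)
    (af : T -> 'M[R]_(p1, q1)) (bf : T -> 'M[R]_(p1, q2))
    (cf : T -> 'M[R]_(p2, q1)) (df : T -> 'M[R]_(p2, q2))
    (a : 'M[R]_(p1, q1)) (b : 'M[R]_(p1, q2))
    (c : 'M[R]_(p2, q1)) (d : 'M[R]_(p2, q2)) :
  af @ F --> a -> bf @ F --> b -> cf @ F --> c -> df @ F --> d ->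
  block_mx (af t) (bf t) (cf t) (df t) @[t --> F] --> block_mx a b c d.
Proof.
move=> cva cvb cvc cvd; apply: cvg_mx => i j.
case: (split_ordP i) => i' ->; case: (split_ordP j) => j' ->.
- by rewrite block_mxEul; under eq_fun do rewrite block_mxEul; exact: cvg_coord.
- by rewrite block_mxEur; under eq_fun do rewrite block_mxEur; exact: cvg_coord.
- by rewrite block_mxEdl; under eq_fun do rewrite block_mxEdl; exact: cvg_coord.
- by rewrite block_mxEdr; under eq_fun do rewrite block_mxEdr; exact: cvg_coord.
Qed.

End MatrixLimits.

Section Compactness.
Variables (R : realType) (N : nat).

(** Heine-Borel for column vectors, transported from row vectors by
    transposition. *)
Lemma bounded_closed_cV_compact (B : R) (K : set 'cV[R]_N) :
  closed K -> (forall v, K v -> forall i, `|v i ord0| <= B) -> compact K.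
Proof.
move=> Kcl KB.
have box : compact [set v : 'rV[R]_N | forall i, v ord0 i \in `[- B, B]].
  apply: (@rV_compact _ _ (fun=> `[- B, B]%classic)) => _.
  exact: segment_compact.
have boxT : compact [set v : 'cV[R]_N | forall i, `|v i ord0| <= B].
  have -> : [set v : 'cV[R]_N | forall i, `|v i ord0| <= B] =
      trmx @` [set v : 'rV[R]_N | forall i, v ord0 i \in `[- B, B]].
    apply/seteqP; split=> [v vB|_ [v vB <-] i]; last first.
      by rewrite mxE ler_norml; have := vB i; rewrite in_itv.
    by exists v^T; rewrite ?trmxK// => i; rewrite mxE in_itv/= -ler_norml.
  apply: continuous_compact box; apply: continuous_subspaceT => v.
  apply: (@cvg_mx _ _ (nbhs v)) => i j; rewrite mxE; under eq_fun do rewrite mxE.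
  exact: coord_continuous.
exact: subclosed_compact Kcl boxT KB.
Qed.

Lemma compact_l1ball (B : R) : compact [set v : 'cV[R]_N | l1norm v <= B].
Proof.
apply: (@bounded_closed_cV_compact B) => [|v vB i].
  apply: (@preimage_closed _ _ (@l1norm R N) [set x | x <= B]); last exact: closed_le.
  by move=> v _; apply: (@cvg_l1norm _ _ (nbhs v)); exact: cvg_id.
by apply: le_trans vB; rewrite /l1norm (bigD1 i)//= lerDl sumr_ge0.
Qed.

Lemma coercive_min (f : 'cV[R]_N -> R) (B : R) :
  continuous f -> (forall v, f v <= f 0 -> forall i, `|v i ord0| <= B) ->
  exists v, forall v', f v <= f v'.
Proof.
move=> fct fB; pose K := [set v | f v <= f 0].
have Kc : compact K.
  apply: (bounded_closed_cV_compact _ fB).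
  apply: (@preimage_closed _ _ f [set x | x <= f 0]); last exact: closed_le.
  by move=> v _; exact: fct.
have [||v /set_mem Kv vmin] := compact_EVT_min _ Kc (f := f).
- by exists 0 => /=; exact: lexx.
- exact: continuous_subspaceT.
exists v => v'; have [/mem_set Kv'|/ltW] := leP (f v') (f 0); first exact: vmin.
exact: le_trans.
Qed.

End Compactness.

(** * A variational inequality of lasso type *)

Section LassoInequality.
Variables (R : realType) (M N : nat).
Implicit Types (C : 'M[R]_(M, N)) (D : 'M[R]_M) (b v : 'cV[R]_M).
Implicit Types (lam mu : R) (w : 'cV[R]_N).

(** The data [D = 1] give the optimality condition of the lasso
    [min_w |b - C w|^2 / 2 + lam |w|_1].  A general [D] turns it into a
    variational inequality that need not come from a minimization. *)
Definition sol C D b lam : set 'cV[R]_N :=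
  [set w | forall w', dot (b - D *m (C *m w)) (C *m (w' - w))
                      <= lam * (l1norm w' - l1norm w)].

Definition strongly_monotone D mu : Prop :=
  forall v, mu * dot v v <= dot (D *m v) v.

(** Testing each of two solutions against the other and adding cancels the
    l1 terms and leaves the monotonicity gap of [D] between the two fits. *)
Lemma sol_fit_unique C D b lam mu w1 w2 :
  strongly_monotone D mu -> 0 < mu ->
  sol C D b lam w1 -> sol C D b lam w2 -> C *m w1 = C *m w2.
Proof.
move=> Dmu mu0 /(_ w2) s1 /(_ w1) s2; apply/eqP; rewrite -subr_eq0; apply/eqP.
apply: dot_eq0P; rewrite -(pmulr_rle0 _ mu0); apply: le_trans (Dmu _) _.
move: s1 s2; rewrite !mulmxBr !dotE; lra.
Qed.

(** The two fits agree, so the left-hand sides vanish when each solution is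
    tested against the other. *)
Lemma sol_l1norm_unique C D b lam mu w1 w2 :
  strongly_monotone D mu -> 0 < mu -> 0 < lam ->
  sol C D b lam w1 -> sol C D b lam w2 -> l1norm w1 = l1norm w2.
Proof.
move=> Dmu mu0 lam0 s1 s2; have fit := sol_fit_unique Dmu mu0 s1 s2.
have := s1 w2; have := s2 w1.
rewrite !mulmxBr fit subrr !(dotC _ 0) !dot0l !pmulr_rge0// !subr_ge0 => le1 le2.
by apply/eqP; rewrite eq_le le1 le2.
Qed.

(** The inequality sees a solution only through its fit and its l1 norm, and a
    smaller l1 norm only helps.  Convexity of the solution set and inner
    semicontinuity both come from here. *)
Lemma sol_stable C D b lam w w' : 0 <= lam -> sol C D b lam w ->
  C *m w' = C *m w -> l1norm w' <= l1norm w -> sol C D b lam w'.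
Proof.
move=> lam0 sw fit le w''; rewrite mulmxBr fit -mulmxBr.
by apply: le_trans (sw w'') _; rewrite ler_wpM2l// lerD2l lerN2.
Qed.

Lemma sol_segment C D b lam mu w1 w2 a :
  strongly_monotone D mu -> 0 < mu -> 0 < lam -> 0 <= a <= 1 ->
  sol C D b lam w1 -> sol C D b lam w2 -> sol C D b lam (w1 + a *: (w2 - w1)).
Proof.
move=> Dmu mu0 lam0 a01 s1 s2; apply: (sol_stable (ltW lam0) s1).
  by rewrite mulmxDr -scalemxAr mulmxBr (sol_fit_unique Dmu mu0 s1 s2) subrr
    scaler0 addr0.
apply: le_trans (l1norm_segment _ _ a01) _.
by rewrite (sol_l1norm_unique Dmu mu0 lam0 s1 s2) subrr mulr0 addr0.
Qed.

(** Test with [0]: [lam |w|_1 + mu |C w|^2 <= <b, C w>], and complete the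
    square. *)
Lemma sol_l1norm_bound C D b lam mu w :
  strongly_monotone D mu -> 0 < mu -> 0 < lam ->
  sol C D b lam w -> l1norm w <= dot b b / (4 * mu * lam).
Proof.
move=> Dmu mu0 lam0 /(_ 0); rewrite sub0r l1norm0 sub0r mulmxN => sw.
have m4 : 0 < 4 * mu * lam by rewrite !mulr_gt0.
rewrite ler_pdivlMr//.
have := Dmu (C *m w); have := dot_ge0 (b - (2 * mu) *: (C *m w)).
move: sw; rewrite !dotE (dotC (C *m w) b); set p := dot b (C *m w).
set q := dot (C *m w) (C *m w); set l := l1norm w.
set d := dot (D *m _) _; set r := dot b b => H1 H2 H3.
have : 0 <= (4 * mu) * (p - d - lam * l) by rewrite mulr_ge0//; lra.
have : 0 <= (4 * mu) * (d - mu * q) by rewrite mulr_ge0//; lra.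
nra.
Qed.

(** At [w = 0] the objective is [|v|^2 / 2], which bounds the sublevel set. *)
Lemma lasso_min C v lam : 0 < lam ->
  exists w, forall w', 2^-1 * dot (v - C *m w) (v - C *m w) + lam * l1norm w
    <= 2^-1 * dot (v - C *m w') (v - C *m w') + lam * l1norm w'.
Proof.
move=> lam0; apply: (coercive_min (B := dot v v / (2 * lam))).
  move=> w; have cvw : v - C *m w' @[w' --> w] --> v - C *m w.
    apply: (@cvgB _ _ _ (nbhs w)); first exact: cvg_cst.
    by apply: (@cvg_mulmx _ _ (nbhs w)); [exact: cvg_cst|exact: cvg_id].
  apply: (@cvgD _ _ _ (nbhs w)); apply: (@cvgM _ _ (nbhs w)); try exact: cvg_cst.
    exact: (@cvg_dot _ _ (nbhs w)).
  by apply: (@cvg_l1norm _ _ (nbhs w)); exact: cvg_id.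
move=> w; rewrite mulmx0 subr0 l1norm0 mulr0 addr0 => le i.
have : `|w i ord0| <= l1norm w by rewrite /l1norm (bigD1 i)//= lerDl sumr_ge0.
rewrite ler_pdivlMr ?mulr_gt0// => /(ler_wpM2l (ltW lam0)).
by have := dot_ge0 (v - C *m w); lra.
Qed.

Lemma lasso_sol C v lam : 0 < lam -> sol C 1%:M v lam !=set0.
Proof.
move=> lam0; have [w wmin] := lasso_min C v lam0; exists w; rewrite /sol/= mul1mx.
apply: (iffLR (l1_composite_minP
  (F := fun z => 2^-1 * dot (v - C *m z) (v - C *m z) + lam * l1norm z)
  (L := fun z => dot (v - C *m w) (C *m z))
  (Q := fun z => 2^-1 * dot (C *m z) (C *m z)) (ltW lam0) _ _ _ _) wmin).
- by move=> z; rewrite mulr_ge0 ?dot_ge0.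
- by move=> t z; rewrite -scalemxAr dotZr.
- by move=> t z; rewrite -scalemxAr dotZr dotZl; ring.
move=> w'; rewrite mulmxBr !dotE (dotC (C *m w') v) (dotC (C *m w) v).
by rewrite (dotC (C *m w') (C *m w)); field.
Qed.

(** The lasso fit is a proximal map on the space of fits, hence nonexpansive. *)
Lemma lasso_fit_nonexpansive C v1 v2 lam w1 w2 :
  sol C 1%:M v1 lam w1 -> sol C 1%:M v2 lam w2 ->
  dot (C *m w1 - C *m w2) (C *m w1 - C *m w2) <= dot (v1 - v2) (v1 - v2).
Proof.
move=> /(_ w2) s1 /(_ w1); move: s1; rewrite !mul1mx !mulmxBr.
have := dot_Young (v1 - v2) (C *m w1 - C *m w2).
rewrite !dotE; lra.
Qed.

(** Forward-backward splitting.  [T] is a step along [- (D v - b)] followed by a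
    lasso fit; it is a contraction for a small step [tau], and a fixed point of
    [T] is the fit of a solution.  The fixed point is found by minimizing
    [|T v - v|^2], which is coercive: replacing [v] by [T v] multiplies it by a
    factor below 1, so its minimum is 0. *)
Lemma sol_exists C D b lam mu : strongly_monotone D mu -> 0 < mu -> mu <= 1 ->
  (forall v, dot (D *m v) (D *m v) <= 4 * dot v v) -> 0 < lam ->
  sol C D b lam !=set0.
Proof.
move=> Dmu mu0 mu1 DL lam0; pose tau := mu / 4.
have tau0 : 0 < tau by rewrite divr_gt0.
have taulam0 : 0 < tau * lam by rewrite mulr_gt0.
have /choice[prox proxP] : forall v, exists w, sol C 1%:M v (tau * lam) w.
  by move=> v; have [w] := lasso_sol C v taulam0; exists w.
pose T v := C *m prox (v - tau *: (D *m v - b)).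
(* The forward step contracts squared distances by
   [1 - 2 tau mu + 4 tau ^ 2], which is [1 - mu ^ 2 / 4] for this [tau]. *)
pose e := mu ^+ 2 / 4.
have e0 : 0 < e by rewrite divr_gt0// exprn_gt0.
have e1 : e < 1 by rewrite ltr_pdivrMr// mul1r; nra.
have Tcontr u v : dot (T u - T v) (T u - T v) <= (1 - e) * dot (u - v) (u - v).
  apply: le_trans (lasso_fit_nonexpansive (proxP _) (proxP _)) _.
  have -> : u - tau *: (D *m u - b) - (v - tau *: (D *m v - b))
      = u - v - tau *: (D *m (u - v)).
    by rewrite mulmxBr; apply/colP => i; rewrite !mxE; ring.
  have := DL (u - v); have := Dmu (u - v).
  move: (u - v) (D *m (u - v)) => x d; rewrite !dotE (dotC x d) => H1 H2.
  have : tau * (mu * dot x x) <= tau * dot d x by rewrite ler_pM2l.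
  have : tau ^+ 2 * dot d d <= tau ^+ 2 * (4 * dot x x).
    by rewrite ler_pM2l// exprn_gt0.
  have -> : e = 2 * tau * mu - 4 * tau ^+ 2 by rewrite /e /tau; field.
  nra.
clearbody e.
have Tct : continuous T.
  move=> v; apply: (@cvg_mx _ _ (nbhs v)) => i j; rewrite ord1.
  apply/cvgrPdist_lt => eps eps0.
  have : dot (v - u) (v - u) @[u --> v] --> dot (v - v) (v - v).
    have cvv : v - u @[u --> v] --> v - v.
      by apply: (@cvgB _ _ _ (nbhs v)); [exact: cvg_cst|exact: cvg_id].
    exact: (@cvg_dot _ _ (nbhs v)).
  rewrite subrr dot0l => /cvgr_lt /(_ (eps ^+ 2)) /(_ (exprn_gt0 _ eps0)).
  apply: filterS => u uv.
  rewrite -(ltr_pXn2r (n := 2)) ?nnegrE ?normr_ge0 ?(ltW eps0)//.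
  rewrite real_normK ?num_real//.
  have := sqr_coord_le_dot (T v - T u) i; rewrite !mxE => /le_lt_trans; apply.
  apply: le_lt_trans uv; apply: le_trans (Tcontr _ _) _.
  by rewrite ler_piMl ?dot_ge0// lerBlDr lerDl ltW.
pose f v := dot (T v - v) (T v - v).
have fct : continuous f.
  move=> v; have cvv : T u - u @[u --> v] --> T v - v.
    by apply: (@cvgB _ _ _ (nbhs v)); [exact: Tct|exact: cvg_id].
  exact: (@cvg_dot _ _ (nbhs v)).
(* [v] is the sum of [a = T v - T 0], with [|a|^2 <= (1 - e) |v|^2], and of
   [c], with [|c|^2 <= 4 f 0].  Weights [1 + e] and [1 + 1 / e] in
   [|a + c|^2] leave [e ^ 2 |v|^2 <= (1 + 1 / e) 4 f 0]. *)
pose B := (1 + e^-1) * (4 * f 0) / e ^+ 2.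
have f00 : 0 <= f 0 by exact: dot_ge0.
have e1p : 0 <= 1 + e^-1 by rewrite addr_ge0 ?invr_ge0 ?(ltW e0).
have B0 : 0 <= B.
  by rewrite /B divr_ge0 ?exprn_ge0 ?(ltW e0)// !mulr_ge0.
have [|beta betamin] := coercive_min (B := 1 + B) fct.
  move=> v fv i.
  have v2 : dot v v <= B.
    rewrite /B ler_pdivlMr ?exprn_gt0//.
    pose a := T v - T 0; pose c := T 0 - (T v - v).
    have vac : v = a + c by apply/colP => j; rewrite !mxE; ring.
    have c4 : dot c c <= 4 * f 0.
      have := dot_ge0 (T 0 + (T v - v)); move: fv; rewrite /f /c subr0 !dotE; lra.
    have av : dot a a <= (1 - e) * dot v v by have := Tcontr v 0; rewrite subr0.
    clearbody a c.
    have : 2 * dot a c <= e * dot a a + e^-1 * dot c c.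
      have := dot_ge0 (e *: a - c); rewrite !dotE (dotC c a) => ac.
      have : 0 <= e^-1 * (e * (e * dot a a) - e * dot a c - (e * dot a c - dot c c)).
        apply: mulr_ge0; first by rewrite invr_ge0 ltW.
        lra.
      rewrite !mulrBr !(mulrA e^-1) mulVf ?gt_eqF// !mul1r; lra.
    have : (1 + e) * dot a a <= (1 + e) * ((1 - e) * dot v v).
      by apply: ler_wpM2l av; rewrite addr_ge0 ?(ltW e0).
    have : (1 + e^-1) * dot c c <= (1 + e^-1) * (4 * f 0).
      exact: ler_wpM2l c4.
    have : dot v v = dot a a + 2 * dot a c + dot c c.
      by rewrite {1 2}vac !dotE (dotC c a); ring.
    nra.
  rewrite -(ler_pXn2r (n := 2)) ?nnegrE ?addr_ge0// real_normK ?num_real//.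
  by have := sqr_coord_le_dot v i; nra.
have fb0 : f beta <= 0.
  have := betamin (T beta); have := Tcontr (T beta) beta; rewrite -/(f _) -/(f _).
  have := dot_ge0 (T beta - beta); rewrite -/(f _); nra.
have Tb : T beta = beta by apply/eqP; rewrite -subr_eq0; apply/eqP/dot_eq0P.
exists (prox (beta - tau *: (D *m beta - b))) => w'.
have := proxP (beta - tau *: (D *m beta - b)) w'.
rewrite /= -!/(T _) mul1mx Tb -mulrA.
have -> : beta - tau *: (D *m beta - b) - beta = tau *: (b - D *m beta).
  by apply/colP => i; rewrite !mxE; ring.
by rewrite dotZl ler_pM2l.
Qed.

End LassoInequality.

(** * Limits of sets along a filter *)

Section SetLimits.
Context {T : Type} {X : topologicalType} {F : set_system T} {FF : Filter F}.
Implicit Types (S : T -> set X) (K L : set X).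

(** Outer and inner limits in neighbourhood form along an arbitrary filter, so
    that limits relative to a subset and limits of sequences are treated
    together. *)
Definition outer_approx S L : Prop :=
  forall x, ~ L x -> \forall x' \near x & t \near F, ~ S t x'.

Definition inner_approx S L : Prop :=
  forall q O, L q -> nbhs q O -> \forall t \near F, exists2 w, S t w & O w.

(** [g t] is the value of [f t] at some point of [S t].  Near each point of [K]
    this value is close to [u] or the point is not in [S t]; compactness makes
    this uniform over [K]. *)
Lemma outer_approx_cvg (U : topologicalType) S L K
    (f : T -> X -> U) (g : T -> U) (u : U) :
  compact K -> outer_approx S L -> (\forall t \near F, S t `<=` K) ->
  (forall x, L x -> f p.2 p.1 @[p --> filter_prod (nbhs x) F] --> u) ->
  (\forall t \near F, exists2 x, S t x & f t x = g t) ->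
  g @ F --> u.
Proof.
move=> /compact_near_coveringP Kcov Sout SK fu gS O uO.
have cov : \forall t \near F, K `<=` [set x | S t x -> O (f t x)].
  apply: (Kcov T F (fun t x => S t x -> O (f t x))) => x Kx.
  have [Lx|nLx] := pselect (L x); last first.
    by apply: filterS (Sout x nLx) => -[x' t] /= nS /nS.
  have fO : filter_prod (nbhs x) F [set p | O (f p.2 p.1)] := fu x Lx O uO.
  by apply: filterS fO => -[x' t].
apply: filterS3 cov SK gS => t cov SK [x Sx fx].
by rewrite /preimage/= -fx; exact: cov (SK _ Sx) Sx.
Qed.

End SetLimits.
Arguments outer_approx {T X} F S L.
Arguments inner_approx {T X} F S L.

Section Nearest.
Context {R : realType} {N : nat}.
Implicit Types (S : set 'cV[R]_N) (w p q : 'cV[R]_N).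

Definition nearest S w : set 'cV[R]_N :=
  [set p | S p /\ forall q, S q -> l2norm (w - p) <= l2norm (w - q)].

Lemma continuous_sqdist w : continuous (fun p => dot (w - p) (w - p)).
Proof.
move=> p; have cvp : w - p' @[p' --> p] --> w - p.
  by apply: (@cvgB _ _ _ (nbhs p)); [exact: cvg_cst|exact: cvg_id].
exact: (@cvg_dot _ _ (nbhs p)).
Qed.

Lemma nearest_exists S w : compact S -> S !=set0 -> nearest S w !=set0.
Proof.
move=> Sc S0.
have [p /set_mem Sp pmin] := compact_EVT_min S0 Sc
  (continuous_subspaceT (@continuous_sqdist w)).
by exists p; split=> // q /mem_set Sq; rewrite l2norm_le pmin.
Qed.

(** Strict convexity of the squared distance, by the parallelogram identity at
    the midpoint. *)
Lemma nearest_unique S w p q :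
  (forall p q, S p -> S q -> S (p + 2^-1 *: (q - p))) ->
  nearest S w p -> nearest S w q -> p = q.
Proof.
move=> Smid [Sp pmin] [Sq qmin]; have := pmin _ (Smid _ _ Sp Sq).
have := qmin _ Sp; rewrite !l2norm_le => qp pm.
apply/eqP; rewrite -subr_eq0; apply/eqP/dot_eq0P.
have -> : p - q = (w - q) - (w - p) by apply/colP => i; rewrite !mxE; ring.
have wm : w - (p + 2^-1 *: (q - p)) = 2^-1 *: ((w - q) + (w - p)).
  by apply/colP => i; rewrite !mxE; field.
move: pm qp; rewrite wm; move: (w - q) (w - p) => b a.
rewrite !dotE (dotC b a); lra.
Qed.

Lemma projP S w : nearest S w !=set0 -> nearest S w (Defs.proj S w).
Proof. by move=> ne; exact: xgetPex. Qed.

(** The nearest-point maps also have an outer limit: if [x] is farther from [w]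
    than some [q] in the limit set, then points of [S t] close to [q] beat every
    point close to [x]. *)
Lemma proj_cvg (T : Type) (F : set_system T) {FF : Filter F}
    (S : T -> set 'cV[R]_N) (L K : set 'cV[R]_N) w :
  compact K -> outer_approx F S L -> inner_approx F S L ->
  (\forall t \near F, S t `<=` K) ->
  (\forall t \near F, nearest (S t) w !=set0) ->
  nearest L w !=set0 ->
  (forall p q, L p -> L q -> L (p + 2^-1 *: (q - p))) ->
  Defs.proj (S t) w @[t --> F] --> Defs.proj L w.
Proof.
move=> Kc Sout Sinn SK Sne L0 Lmid.
apply: (outer_approx_cvg (S := fun t => nearest (S t) w) (L := nearest L w)
  (f := fun _ x => x) Kc).
- move=> x nx; have [Lx|nLx] := pselect (L x); last first.
    by apply: filterS (Sout x nLx) => -[x' t] /= nS [/nS].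
  have [q [Lq qx]] : exists q, L q /\ dot (w - q) (w - q) < dot (w - x) (w - x).
    apply: contra_notP nx => nq; split=> // q Lq; rewrite l2norm_le leNgt.
    by apply/negP => qx; apply: nq; exists q.
  pose r := (dot (w - q) (w - q) + dot (w - x) (w - x)) / 2.
  have [qr rx] : dot (w - q) (w - q) < r /\ r < dot (w - x) (w - x).
    by rewrite /r; split; lra.
  exists ([set x' | r < dot (w - x') (w - x')],
          [set t | exists2 q', S t q' & dot (w - q') (w - q') < r]) => /=.
    split; first exact: (cvgr_gt _ (@continuous_sqdist w x)).
    exact: Sinn Lq (cvgr_lt _ (@continuous_sqdist w q) _ qr).
  move=> -[x' t] /= [rx' [q' Stq' q'r]] [_ /(_ q' Stq')].
  by rewrite l2norm_le leNgt (lt_trans q'r).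
- by apply: filterS SK => t SK p [/SK].
- move=> x nx; rewrite -(nearest_unique Lmid nx (projP L0)).
  exact: cvg_fst.
- by apply: filterS Sne => t Sne; exists (Defs.proj (S t) w) => //; exact: projP.
Qed.

End Nearest.

Lemma nearest_self (R : realType) (N : nat) (S : set 'cV[R]_N) q :
  S q -> nearest S q q.
Proof.
by move=> Sq; split=> // p _; rewrite l2norm_le subrr dot0l dot_ge0.
Qed.

Section NearEquality.
Context {T : Type} {X : topologicalType} {F : set_system T} {FF : Filter F}.
Variables (S S' : T -> set X) (L : set X).
Hypothesis SS' : \forall t \near F, S t = S' t.

Lemma outer_approx_near_eq : outer_approx F S L -> outer_approx F S' L.
Proof.
move=> Sout x nLx; have [[A B] /= [xA FB] AB] := Sout x nLx.
exists (A, B `&` [set t | S t = S' t]) => /=; first by split=> //; exact: filterI.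
by move=> -[y t] /= [Ay [Bt <-]]; exact: AB (y, t) _.
Qed.

Lemma inner_approx_near_eq : inner_approx F S L -> inner_approx F S' L.
Proof.
by move=> Sinn q O Lq qO; apply: filterS2 SS' (Sinn q O Lq qO) => t ->.
Qed.

End NearEquality.

(** * Dependence of the solutions on the data *)

Section PolyhedralNorm.
Variables (R : realType) (N : nat).
Implicit Types (x y q : 'cV[R]_N) (s : {ffun 'I_N -> bool}).

(** The l1 norm is the maximum of the linear forms [dot (signs s)]. *)
Definition signs s : 'cV[R]_N := \col_i (-1) ^+ s i.

Lemma dot_signs_le s x : dot (signs s) x <= l1norm x.
Proof.
apply: ler_sum => i _; rewrite mxE; apply: le_trans (ler_norm _) _.
by rewrite normrM normrX normrN1 expr1n mul1r.
Qed.

Lemma l1norm_signs x : l1norm x = dot (signs [ffun i => x i ord0 < 0]) x.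
Proof.
apply: eq_bigr => i _; rewrite mxE ffunE.
have [x0|x0] := ltP (x i ord0) 0.
  by rewrite expr1 mulN1r ltr0_norm.
by rewrite expr0 mul1r ger0_norm.
Qed.

(** This is where polyhedrality enters.  A sign vector [s] that attains the norm
    at [x] satisfies [<s, q - x> <= 0], so its linear form does not increase from
    any starting point.  The other sign vectors have slack at [x], and [t < 1]
    leaves part of it to absorb the displacement of [y] from [x]. *)
Lemma l1norm_shift_near x q t : 0 <= t < 1 -> l1norm q <= l1norm x ->
  \forall y \near x, l1norm (y + t *: (q - x)) <= l1norm y.
Proof.
move=> /andP[t0 t1] qx.
have : \forall y \near x, forall s, dot (signs s) (y + t *: (q - x)) <= l1norm y.
  apply: (filter_forall (F := nbhs x)
    (f := fun s y => dot (signs s) (y + t *: (q - x)) <= l1norm y)) => s.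
  have [tight|slack] := eqVneq (dot (signs s) x) (l1norm x).
    apply: nearW => y; have := dot_signs_le s y; have := dot_signs_le s q.
    move=> sq sy; have : t * (dot (signs s) q - dot (signs s) x) <= 0.
      by rewrite mulr_ge0_le0// subr_le0 tight; exact: le_trans sq qx.
    rewrite !dotE; lra.
  have {}slack : dot (signs s) x < l1norm x by rewrite lt_neqAle slack dot_signs_le.
  have cvy : l1norm y - dot (signs s) y @[y --> x] --> l1norm x - dot (signs s) x.
    apply: (@cvgB _ _ _ (nbhs x)).
      by apply: (@cvg_l1norm _ _ (nbhs x)); exact: cvg_id.
    by apply: (@cvg_dot _ _ (nbhs x)); [exact: cvg_cst|exact: cvg_id].
  have below : t * (dot (signs s) q - dot (signs s) x) < l1norm x - dot (signs s) x.
    have : t * (dot (signs s) q - dot (signs s) x) <= t * (l1norm x - dot (signs s) x).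
      by rewrite ler_wpM2l// lerB// (le_trans (dot_signs_le _ _)).
    move/le_lt_trans; apply; rewrite -[ltRHS]mul1r ltr_pM2r//; lra.
  apply: filterS (cvgr_gt _ cvy _ below) => y; rewrite !dotE; lra.
by apply: filterS => y /(_ [ffun i => (y + t *: (q - x)) i ord0 < 0]);
  rewrite -l1norm_signs.
Qed.

End PolyhedralNorm.

Section SolutionMap.
Context {R : realType} {M N : nat} {T : Type} {F : set_system T} {FF : Filter F}.
Variables (Cf : T -> 'M[R]_(M, N)) (Df : T -> 'M[R]_M) (bf : T -> 'cV[R]_M)
  (lf : T -> R).
Variables (C : 'M[R]_(M, N)) (D : 'M[R]_M) (b : 'cV[R]_M) (l : R).
Hypotheses (cvC : Cf @ F --> C) (cvD : Df @ F --> D) (cvb : bf @ F --> b)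
  (cvl : lf @ F --> l).

Let S t := sol (Cf t) (Df t) (bf t) (lf t).

(** A violated inequality stays violated nearby, as the gap depends continuously
    on the data and on the point. *)
Lemma sol_outer : outer_approx F S (sol C D b l).
Proof.
move=> w /existsNP[w' /negP]; rewrite -ltNge => gap.
pose h p := dot (bf p.2 - Df p.2 *m (Cf p.2 *m p.1)) (Cf p.2 *m (w' - p.1))
  - lf p.2 * (l1norm w' - l1norm p.1).
pose G := filter_prod (nbhs w) F; have FG : Filter G by exact: filter_prod_filter.
have cvh : h p @[p --> G] --> dot (b - D *m (C *m w)) (C *m (w' - w))
    - l * (l1norm w' - l1norm w).
  have cw : p.1 @[p --> G] --> w by exact: cvg_fst.
  have snd (U : Type) (k : T -> U) (L : set_system U) :
      k @ F --> L -> k p.2 @[p --> G] --> L.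
    by move=> ku; exact: (cvg_comp _ _ cvg_snd ku).
  have cb := snd _ _ _ cvb; have cl := snd _ _ _ cvl.
  have cD := snd _ _ _ cvD; have cC := snd _ _ _ cvC.
  have cCw := @cvg_mulmx _ _ _ FG _ _ _ _ _ _ _ cC cw.
  have cDCw := @cvg_mulmx _ _ _ FG _ _ _ _ _ _ _ cD cCw.
  have cw' : w' - p.1 @[p --> G] --> w' - w by exact: cvgB (cvg_cst _) cw.
  have cCw' := @cvg_mulmx _ _ _ FG _ _ _ _ _ _ _ cC cw'.
  have cl1 : l1norm w' - l1norm p.1 @[p --> G] --> l1norm w' - l1norm w.
    exact: cvgB (cvg_cst _) (cvg_l1norm cw).
  exact: cvgB (cvg_dot (cvgB cb cDCw) cCw') (cvgM cl cl1).
have hpos : 0 < dot (b - D *m (C *m w)) (C *m (w' - w)) - l * (l1norm w' - l1norm w).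
  by rewrite subr_gt0.
have hG : G [set p | 0 < h p] := @cvgr_gt _ _ G FG _ _ cvh _ hpos.
suff : G [set p | ~ S p.2 p.1] by [].
apply: (@filterS _ G FG _ _ _ hG) => -[x' t]; rewrite /= /h/= subr_gt0 => gap' /(_ w').
by rewrite leNgt gap'.
Qed.

Variables (mf : T -> R) (mu : R).
Hypotheses (cvmu : mf @ F --> mu) (mu0 : 0 < mu) (l0 : 0 < l).
Hypotheses (Dmu : strongly_monotone D mu)
  (Dfmu : \forall t \near F, strongly_monotone (Df t) (mf t)).
Hypothesis Sne : \forall t \near F, S t !=set0.

Let bound := dot b b / (4 * mu * l) + 1.
Let K : set 'cV[R]_N := [set w | l1norm w <= bound].

Lemma sol_near_bounded : \forall t \near F, S t `<=` K.
Proof.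
have cvB : dot (bf t) (bf t) / (4 * mf t * lf t) @[t --> F] --> dot b b / (4 * mu * l).
  apply: cvgM; first exact: cvg_dot.
  apply: cvgV; first by rewrite gt_eqF// !mulr_gt0.
  by apply: cvgM => //; apply: cvgM => //; exact: cvg_cst.
have B1 : dot b b / (4 * mu * l) < bound by rewrite ltrDl.
near=> t => w Sw.
have Dt : strongly_monotone (Df t) (mf t) by near: t.
have mt : 0 < mf t by near: t; exact: (cvgr_gt _ cvmu).
have lt : 0 < lf t by near: t; exact: (cvgr_gt _ cvl).
apply: le_trans (sol_l1norm_bound Dt mt lt Sw) _.
by apply/ltW; near: t; exact: (cvgr_lt _ cvB).
Unshelve. all: by end_near. Qed.

Lemma sol_cvg (U : topologicalType) (f : T -> 'cV[R]_N -> U) (g : T -> U) (u : U) :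
  (forall x, sol C D b l x -> f p.2 p.1 @[p --> filter_prod (nbhs x) F] --> u) ->
  (\forall t \near F, forall x, S t x -> f t x = g t) ->
  g @ F --> u.
Proof.
move=> fu fg; apply: (outer_approx_cvg (@compact_l1ball _ _ bound) sol_outer
  sol_near_bounded fu).
by apply: filterS2 fg Sne => t fg [x Sx]; exists x => //; exact: fg.
Qed.

(** Each point [y] of [S t] close to a limit solution [x] can be moved along
    [q - x] inside [S t] to a point close to [q].  Only this argument needs the
    matrix [C] to stay fixed: otherwise the move changes the fit. *)
Lemma sol_inner : (forall t, Cf t = C) -> inner_approx F S (sol C D b l).
Proof.
move=> Cconst q O Sq qO.
have cov : \forall t \near F,
    K `<=` [set x | S t x -> exists2 w, S t w & O w].
  apply: (iffLR (compact_near_coveringP _) (@compact_l1ball _ _ bound) T F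
    (fun t x => S t x -> exists2 w, S t w & O w)) => x _.
  have [Sx|nSx] := pselect (sol C D b l x); last first.
    by apply: filterS (sol_outer nSx) => -[x' t] /= nS /nS.
  have [tau [tau01 tauO]] : exists tau : R, 0 <= tau < 1 /\ nbhs (x + tau *: (q - x)) O.
    have cvtau : x + tau *: (q - x) @[tau --> 1^'-] --> q.
      rewrite -[X in _ --> X](subrKC x); apply: cvgD; first exact: cvg_cst.
      rewrite -[X in _ --> X]scale1r; apply: cvgZr_tmp.
      by apply: cvg_at_left_filter; exact: cvg_id.
    have tauO : \forall tau \near (1 : R)^'-, nbhs (x + tau *: (q - x)) O.
      exact: cvtau (nbhs_interior qO).
    near (1 : R)^'- => tau; exists tau; split; last by near: tau.
    by apply/andP; split; near: tau; [exact: nbhs_left_ge|exact: nbhs_left_lt].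
  have shift : \forall y \near x, O (y + tau *: (q - x)).
    have cvy : y + tau *: (q - x) @[y --> x] --> x + tau *: (q - x).
      by apply: (@cvgD _ _ _ (nbhs x)); [exact: cvg_id|exact: cvg_cst].
    exact: cvy.
  have le1 := l1norm_shift_near tau01 (eq_ind_r (fun a => a <= l1norm x) (lexx _)
     (sol_l1norm_unique Dmu mu0 l0 Sq Sx)).
  exists ([set y | O (y + tau *: (q - x)) /\ l1norm (y + tau *: (q - x)) <= l1norm y],
          [set t | 0 < lf t]).
    by split; [exact: filterI|exact: (cvgr_gt _ cvl)].
  move=> -[y t] /= [[Oy ley] lt] Sy; exists (y + tau *: (q - x)) => //.
  apply: (sol_stable (ltW lt) Sy _ ley).
  rewrite mulmxDr -scalemxAr mulmxBr Cconst (sol_fit_unique Dmu mu0 Sq Sx).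
  by rewrite subrr scaler0 addr0.
apply: filterS3 cov sol_near_bounded Sne => t cov SK [x Sx].
exact: cov (SK _ Sx) Sx.
Unshelve. all: by end_near. Qed.

End SolutionMap.

Lemma sol_compact (R : realType) (M N : nat) (C : 'M[R]_(M, N)) (D : 'M[R]_M)
    (b : 'cV[R]_M) (l mu : R) :
  strongly_monotone D mu -> 0 < mu -> 0 < l -> compact (sol C D b l).
Proof.
move=> Dmu mu0 l0.
apply: subclosed_compact (@compact_l1ball _ _ (dot b b / (4 * mu * l))) _.
  (* Closedness is [sol_outer] for constant data. *)
  move=> x xcl; apply: contrapT => nSx.
  have [[U V] /= [xU [k _ Vk]] UV] :=
    @sol_outer _ _ _ nat \oo _ (fun=> C) (fun=> D) (fun=> b) (fun=> l) _ _ _ _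
      (cvg_cst C) (cvg_cst D) (cvg_cst b) (cvg_cst l) x nSx.
  have [y [Sy Uy]] := xcl _ xU.
  by have /= := UV (y, k); apply=> //; split=> //; apply: Vk => /=.
by move=> w; exact: sol_l1norm_bound Dmu mu0 l0.
Qed.

(** * Saddle points as solutions of the variational inequality *)

Section SaddlePoints.
Variables (R : realType) (m n : nat).
Implicit Types (A : 'M[R]_(m, n)) (rho lam : R).

(** With [w = (x, z)], the rows of [b - Dmx rho (C w)] tested against [C (w' - w)]
    are minus the partial gradient in [x] and the partial gradient in [z] of the
    smooth part of the objective.  The off-diagonal blocks are skew, as in every
    min-max problem. *)
Definition Dmx rho : 'M[R]_(m + m) :=
  block_mx ((1 - rho) *: 1%:M) (Num.sqrt rho *: 1%:M)
           (- Num.sqrt rho *: 1%:M) 1%:M.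

Lemma Dmx_mul rho (p q : 'cV[R]_m) :
  Dmx rho *m col_mx p q
  = col_mx ((1 - rho) *: p + Num.sqrt rho *: q) (- Num.sqrt rho *: p + q).
Proof. by rewrite mul_block_col -!scalemxAl !mul1mx. Qed.

Lemma Dmx_monotone rho : 0 <= rho -> strongly_monotone (Dmx rho) (1 - rho).
Proof.
move=> rho0 v; rewrite -[v]vsubmxK Dmx_mul !dot_col !dotE.
rewrite (dotC (dsubmx v) (usubmx v)).
have := mulr_ge0 rho0 (dot_ge0 (dsubmx v)); lra.
Qed.

Lemma Dmx_bound rho (v : 'cV[R]_(m + m)) : 0 <= rho < 1 ->
  dot (Dmx rho *m v) (Dmx rho *m v) <= 4 * dot v v.
Proof.
move=> /andP[rho0 rho1]; rewrite -[v]vsubmxK Dmx_mul !dot_col.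
move: (usubmx v) (dsubmx v) => p q.
have s0 : 0 <= Num.sqrt rho := sqrtr_ge0 _.
have s2 : Num.sqrt rho ^+ 2 = rho by rewrite sqr_sqrtr.
set s := Num.sqrt rho in s0 s2 *; rewrite -s2 in rho0 rho1 *; clearbody s.
have s1 : s <= 1 by rewrite -(ler_pXn2r (n := 2)) ?nnegrE// expr1n ltW.
have pq : - (2 * dot p q) <= dot p p + dot q q.
  by have := dot_ge0 (p + q); rewrite !dotE (dotC q p); lra.
rewrite !dotE (dotC q p); have := dot_ge0 p; have := dot_ge0 q.
move: (dot p p) (dot q q) (dot p q) pq => a b c pq b0 a0.
have s3 : s ^+ 3 * - (2 * c) <= s ^+ 3 * (a + b) by rewrite ler_wpM2l ?exprn_ge0.
have s31 : s ^+ 3 <= 1 by rewrite exprn_ile1.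
have s41 : s ^+ 4 <= 1 by rewrite exprn_ile1.
have s21 : s ^+ 2 <= 1 by rewrite exprn_ile1.
have := ler_wpM2r (addr_ge0 a0 b0) s31; have := ler_wpM2r a0 s41.
have := ler_wpM2r b0 s21; have := mulr_ge0 (sqr_ge0 s) a0; nra.
Qed.

Lemma Cmx_mul A rho (w : 'cV[R]_(n + n)) :
  Cmx A rho *m w
  = col_mx (A *m usubmx w) (Num.sqrt rho *: (A *m dsubmx w)).
Proof.
by rewrite -{1}[w]vsubmxK mul_block_col !mul0mx addr0 add0r -scalemxAl.
Qed.

(** [Gobj] is a convex quadratic plus a multiple of the l1 norm in [x], and so is
    [- Gobj] in [z].  The first-order conditions of the two problems are the
    tests of the variational inequality that change only one block of [w], and
    they add up to the general test. *)
Lemma Se_sol A rho b lam : 0 <= rho < 1 -> 0 < lam ->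
  Se (A, rho, b, lam) = sol (Cmx A rho) (Dmx rho) b lam.
Proof.
move=> /andP[rho0 rho1] lam0; apply/seteqP.
set s := Num.sqrt rho; have s2 : s * s = rho by rewrite -expr2 sqr_sqrtr.
pose y := usubmx b; pose r := dsubmx b.
pose Lx (w : 'cV[R]_(n + n)) v :=
  dot (y - (1 - rho) *: (A *m usubmx w) - rho *: (A *m dsubmx w)) (A *m v).
pose Lz (w : 'cV[R]_(n + n)) v :=
  dot (s *: r + rho *: (A *m usubmx w) - rho *: (A *m dsubmx w)) (A *m v).
have rE (z : 'cV[R]_n) : (r^T *m A *m z) ord0 ord0 = dot r (A *m z).
  by rewrite -mulmxA mxE; apply: eq_bigr => i _; rewrite mxE.
have xP w : (forall x', Gobj A rho y r lam (usubmx w) (dsubmx w)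
    <= Gobj A rho y r lam x' (dsubmx w)) <->
    (forall x', Lx w (x' - usubmx w) <= lam * (l1norm x' - l1norm (usubmx w))).
  refine (l1_composite_minP (x := usubmx w)
    (F := fun x => Gobj A rho y r lam x (dsubmx w))
    (L := Lx w) (Q := fun v => (1 - rho) / 2 * dot (A *m v) (A *m v)) (ltW lam0)
    _ _ _ _).
  - by move=> v; rewrite mulr_ge0 ?dot_ge0 ?divr_ge0// subr_ge0 ltW.
  - by move=> t v; rewrite /Lx -scalemxAr dotZr.
  - by move=> t v; rewrite -scalemxAr !dotE; ring.
  move=> x'; rewrite /Gobj /Lx !rE !l2norm_sqr !mulmxBr.
  move: (usubmx w) (dsubmx w) => x z; rewrite !dotE.
  rewrite (dotC (A *m x') y) (dotC (A *m x) y) (dotC (A *m z) (A *m x)).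
  rewrite (dotC (A *m z) (A *m x')) (dotC (A *m x') (A *m x)).
  by field.
have zP w : (forall z', Gobj A rho y r lam (usubmx w) z'
    <= Gobj A rho y r lam (usubmx w) (dsubmx w)) <->
    (forall z', Lz w (z' - dsubmx w) <= lam * (l1norm z' - l1norm (dsubmx w))).
  apply: (@iff_trans _ (forall z', - Gobj A rho y r lam (usubmx w) (dsubmx w)
       <= - Gobj A rho y r lam (usubmx w) z')).
    by split=> H z'; have := H z'; rewrite lerN2.
  refine (l1_composite_minP (x := dsubmx w)
    (F := fun z => - Gobj A rho y r lam (usubmx w) z)
    (L := Lz w) (Q := fun v => rho / 2 * dot (A *m v) (A *m v)) (ltW lam0)
    _ _ _ _).
  - by move=> v; rewrite mulr_ge0 ?dot_ge0 ?divr_ge0.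
  - by move=> t v; rewrite /Lz -scalemxAr dotZr.
  - by move=> t v; rewrite -scalemxAr !dotE; ring.
  move=> z'; rewrite /Gobj /Lz !rE !l2norm_sqr !mulmxBr -/s.
  move: (usubmx w) (dsubmx w) => x z; rewrite !dotE.
  rewrite (dotC (A *m z) (A *m x)) (dotC (A *m z') (A *m x)).
  by rewrite (dotC (A *m z') (A *m z)); field.
have solE w w' : dot (b - Dmx rho *m (Cmx A rho *m w)) (Cmx A rho *m (w' - w))
    = Lx w (usubmx w' - usubmx w) + Lz w (dsubmx w' - dsubmx w).
  rewrite !Cmx_mul Dmx_mul -/s -{1}[b]vsubmxK -/y -/r opp_col_mx add_col_mx.
  rewrite !linearB/= dot_col /Lx /Lz -s2 !mulmxBr !dotE; ring.
split=> w /=.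
  move=> saddle w'; rewrite solE !l1norm_col.
  have := iffLR (xP w) (fun x' => (saddle x' (dsubmx w)).2) (usubmx w').
  have := iffLR (zP w) (fun z' => (saddle (usubmx w) z').1) (dsubmx w').
  lra.
move=> ws; have xs x' : Lx w (x' - usubmx w) <= lam * (l1norm x' - l1norm (usubmx w)).
  have := ws (col_mx x' (dsubmx w)); rewrite solE !l1norm_col col_mxKu col_mxKd.
  by rewrite subrr /Lz mulmx0 (dotC _ 0) dot0l; lra.
have zs z' : Lz w (z' - dsubmx w) <= lam * (l1norm z' - l1norm (dsubmx w)).
  have := ws (col_mx (usubmx w) z'); rewrite solE !l1norm_col col_mxKu col_mxKd.
  by rewrite subrr /Lx mulmx0 (dotC _ 0) dot0l; lra.
by move=> x' z'; split; [exact: (iffRL (zP w))|exact: (iffRL (xP w))].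
Qed.

End SaddlePoints.

(** * Continuity in the parameters of the model *)

Section SolutionSet.
Context {R : realType} {m n : nat}.
Local Notation param := ('M[R]_(m, n) * R * 'cV[R]_(m + m) * R)%type.
Implicit Types t : param.

Definition fit_mx t := Cmx t.1.1.1 t.1.1.2.
Definition vi_mx t := Dmx m t.1.1.2.

Lemma paramsetP t : paramset t ->
  (0 <= t.1.1.2 < 1) * (0 < t.2) * (0 < 1 - t.1.1.2).
Proof.
by case: t => [[[A rho] b] l] /= [/andP[-> r1] ->]; rewrite r1 subr_gt0.
Qed.

Lemma vi_mx_monotone t : paramset t -> strongly_monotone (vi_mx t) (1 - t.1.1.2).
Proof. by move=> /paramsetP[[/andP[rho0 _] _] _]; exact: Dmx_monotone. Qed.

Lemma SeE t : paramset t -> Se t = sol (fit_mx t) (vi_mx t) t.1.2 t.2.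
Proof. by case: t => [[[A rho] b] l] [? ?]; exact: Se_sol. Qed.

Lemma Se_neq0 t : paramset t -> Se t !=set0.
Proof.
move=> tP; rewrite SeE//; have [[rho01 l0] mu0] := paramsetP tP.
apply: sol_exists (vi_mx_monotone tP) mu0 _ _ l0; last first.
  by move=> v; exact: Dmx_bound.
by rewrite lerBlDr lerDl; case/andP: rho01.
Qed.

Lemma Se_compact t : paramset t -> compact (Se t).
Proof.
move=> tP; rewrite SeE//; have [[_ l0] mu0] := paramsetP tP.
exact: sol_compact (vi_mx_monotone tP) mu0 l0.
Qed.

Lemma Se_midpoint t p q : paramset t -> Se t p -> Se t q ->
  Se t (p + 2^-1 *: (q - p)).
Proof.
move=> tP; rewrite !SeE//; have [[_ l0] mu0] := paramsetP tP.
by apply: sol_segment (vi_mx_monotone tP) mu0 l0 _; lra.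
Qed.

Lemma beta_eE t w : paramset t -> Se t w -> beta_e t = fit_mx t *m w.
Proof.
move=> tP Sw; have -> : beta_e t = xget 0 [set fit_mx t *m w | w in Se t].
  by case: t {tP Sw} => [[[]]].
apply: xget_unique; first by exists w.
move=> _ [w' Sw' <-]; move: Sw Sw'; rewrite !SeE// => Sw Sw'.
exact: sol_fit_unique (vi_mx_monotone tP) (paramsetP tP).2 Sw' Sw.
Qed.

Lemma gamma_eE t w : paramset t -> Se t w -> gamma_e t = l1norm w.
Proof.
move=> tP Sw; apply: xget_unique; first by exists w.
move=> _ [w' Sw' <-]; move: Sw Sw'; rewrite !SeE// => Sw Sw'.
have [[_ l0] mu0] := paramsetP tP.
exact: sol_l1norm_unique (vi_mx_monotone tP) mu0 l0 Sw' Sw.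
Qed.

End SolutionSet.

Section ParameterLimits.
Context {R : realType} {m n : nat} {T : Type} {F : set_system T} {FF : Filter F}.
Local Notation param := ('M[R]_(m, n) * R * 'cV[R]_(m + m) * R)%type.
Variables (tf : T -> param) (t : param).
Hypotheses (cvt : tf @ F --> t) (tP : paramset t)
  (tfP : \forall k \near F, paramset (tf k)).

Let cvl : (tf k).2 @[k --> F] --> t.2.
Proof. exact: (cvg_comp _ _ cvt cvg_snd). Qed.
Let cvb : (tf k).1.2 @[k --> F] --> t.1.2.
Proof. exact: (cvg_comp _ _ (cvg_comp _ _ cvt cvg_fst) cvg_snd). Qed.
Let cvrho : (tf k).1.1.2 @[k --> F] --> t.1.1.2.
Proof.
exact: (cvg_comp _ _ (cvg_comp _ _ (cvg_comp _ _ cvt cvg_fst) cvg_fst) cvg_snd).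
Qed.
Let cvA : (tf k).1.1.1 @[k --> F] --> t.1.1.1.
Proof.
exact: (cvg_comp _ _ (cvg_comp _ _ (cvg_comp _ _ cvt cvg_fst) cvg_fst) cvg_fst).
Qed.
Let cvsqrt : Num.sqrt (tf k).1.1.2 @[k --> F] --> Num.sqrt t.1.1.2.
Proof. exact: (cvg_comp _ _ cvrho (@sqrt_continuous R _)). Qed.
Let cvmu : 1 - (tf k).1.1.2 @[k --> F] --> 1 - t.1.1.2.
Proof. by apply: cvgB => //; exact: cvg_cst. Qed.

Let cvC : fit_mx (tf k) @[k --> F] --> fit_mx t.
Proof.
by apply: cvg_block_mx; [exact: cvA|exact: cvg_cst|exact: cvg_cst|exact: cvgZ].
Qed.

Let cvD : vi_mx (tf k) @[k --> F] --> vi_mx t.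
Proof.
apply: cvg_block_mx; [| | |exact: cvg_cst]; apply: cvgZr_tmp => //.
exact: cvgN.
Qed.

Let Dmu : strongly_monotone (vi_mx t) (1 - t.1.1.2) := vi_mx_monotone tP.
Let Dfmu : \forall k \near F, strongly_monotone (vi_mx (tf k)) (1 - (tf k).1.1.2).
Proof. by apply: filterS tfP => k; exact: vi_mx_monotone. Qed.

Let l0 : 0 < t.2 := (paramsetP tP).1.2.
Let mu0 : 0 < 1 - t.1.1.2 := (paramsetP tP).2.

Let SfE : \forall k \near F,
  sol (fit_mx (tf k)) (vi_mx (tf k)) (tf k).1.2 (tf k).2 = Se (tf k).
Proof. by apply: filterS tfP => k kP; rewrite SeE. Qed.

Let Sne : \forall k \near F,
  sol (fit_mx (tf k)) (vi_mx (tf k)) (tf k).1.2 (tf k).2 !=set0.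
Proof. by apply: filterS2 SfE tfP => k -> kP; exact: Se_neq0. Qed.

Lemma Se_outer : outer_approx F (fun k => Se (tf k)) (Se t).
Proof.
rewrite SeE//; exact: outer_approx_near_eq SfE (sol_outer cvC cvD cvb cvl).
Qed.

(** [beta_e] and [gamma_e] are values of continuous functions at any solution,
    so [sol_cvg] applies. *)
Lemma beta_e_cvg : beta_e (tf k) @[k --> F] --> beta_e t.
Proof.
apply: (sol_cvg cvC cvD cvb cvl cvmu mu0 l0 Dfmu Sne
  (f := fun k x => fit_mx (tf k) *m x)).
- move=> x; rewrite -SeE// => Sx; rewrite (beta_eE tP Sx).
  apply: cvg_mulmx; last exact: cvg_fst.
  exact: (cvg_comp _ _ cvg_snd cvC).
- by apply: filterS2 SfE tfP => k -> kP x /(beta_eE kP).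
Qed.

Lemma gamma_e_cvg : gamma_e (tf k) @[k --> F] --> gamma_e t.
Proof.
apply: (sol_cvg cvC cvD cvb cvl cvmu mu0 l0 Dfmu Sne (f := fun k x => l1norm x)).
- move=> x; rewrite -SeE// => Sx; rewrite (gamma_eE tP Sx).
  by apply: cvg_l1norm; exact: cvg_fst.
- by apply: filterS2 SfE tfP => k -> kP x /(gamma_eE kP).
Qed.

Lemma PSe_cvg wbar : (forall k, (tf k).1.1 = t.1.1) ->
  PSe wbar (tf k) @[k --> F] --> PSe wbar t.
Proof.
move=> Ct; have Cfix k : fit_mx (tf k) = fit_mx t by rewrite /fit_mx Ct.
rewrite /PSe; apply: (proj_cvg (S := fun k => Se (tf k)) (L := Se t)
  (@compact_l1ball _ _ _) Se_outer).
- rewrite SeE//; apply: inner_approx_near_eq SfE _.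
  exact: (sol_inner cvC cvD cvb cvl cvmu mu0 l0 Dmu Dfmu Sne).
- apply: filterS2 SfE
    (sol_near_bounded (fun k => fit_mx (tf k)) cvb cvl cvmu mu0 l0 Dfmu).
  by move=> k ->; exact.
- apply: filterS tfP => k kP.
  by apply: nearest_exists; [exact: Se_compact|exact: Se_neq0].
- by apply: nearest_exists; [exact: Se_compact|exact: Se_neq0].
- by move=> p q; exact: Se_midpoint.
Qed.

End ParameterLimits.

(** A cluster point has members of the sequence nearby at arbitrarily late
    indices. *)
Lemma osc_of_outer_approx (V : topologicalType) (S : nat -> set V) (L : set V) :
  outer_approx \oo S L -> outer_limit S `<=` L.
Proof.
move=> Sout x [u [Su ux]]; apply: contrapT => nLx.
have [[A B] /= [xA FB] AB] := Sout x nLx.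
have [|y [[k Bk <-] Ay]] := ux [set u k | k in B] A _ xA.
  by apply: filterS FB => k Bk; exists k.
exact: AB (u k, k) _ (Su k).
Qed.

Theorem theorem2 (R : realType) (m n : nat) (m_gt0 : (0 < m)%N)
    (n_gt0 : (0 < n)%N) :
  (outer_semicontinuous_on (@paramset R m n) (@Se R m n)
   /\ {within @paramset R m n, continuous (@beta_e R m n)}
   /\ {within @paramset R m n, continuous (@gamma_e R m n)})
  /\
  (forall (A : 'M[R]_(m, n)) (rho : R), 0 <= rho < 1 ->
    let D : set ('cV[R]_(m + m) * R) := [set bl | 0 < bl.2] in
    set_continuous_on D (fun bl => Se (A, rho, bl.1, bl.2))
    /\ (forall wbar : 'cV[R]_(n + n),
         {within D, continuous (fun bl => PSe wbar (A, rho, bl.1, bl.2))})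
    /\ {within D, continuous (fun bl => w_star (A, rho, bl.1, bl.2))}).
Proof.
split.
  split; [|split].
  - move=> t tP s sP st; apply: osc_of_outer_approx.
    exact: (Se_outer st tP (nearW _ sP)).
  - apply/subspace_continuousP => t tP.
    by apply: (beta_e_cvg (tf := id) _ tP (near_withinT _ _)); exact: cvg_within.
  - apply/subspace_continuousP => t tP.
    by apply: (gamma_e_cvg (tf := id) _ tP (near_withinT _ _)); exact: cvg_within.
move=> A rho rho01 D.
pose tf (bl : 'cV[R]_(m + m) * R) := (A, rho, bl.1, bl.2).
have tfcv T (F : set_system T) (s : T -> 'cV[R]_(m + m) * R) bl : Filter F ->
    s @ F --> bl -> tf (s k) @[k --> F] --> tf bl.
  move=> FF sbl.
  have cv1 : (s k).1 @[k --> F] --> bl.1 by exact: (cvg_comp _ _ sbl cvg_fst).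
  have cv2 : (s k).2 @[k --> F] --> bl.2 by exact: (cvg_comp _ _ sbl cvg_snd).
  have cvA : (fun=> (A, rho)) @ F --> (A, rho) by exact: cvg_cst.
  exact: (cvg_pair (cvg_pair cvA cv1) cv2).
have tfP bl : D bl -> paramset (tf bl) by [].
have PSect wbar : {within D, continuous (fun bl => PSe wbar (tf bl))}.
  apply/subspace_continuousP => bl blD.
  apply: (PSe_cvg _ (tfP _ blD)) => //.
    by apply: (tfcv _ _ id) => //; exact: cvg_within.
  by apply: filterS (near_withinT D _) => bl'; exact: tfP.
split; [|by split=> //; exact: PSect].
move=> bl blD; split=> s sD sbl.
  apply: osc_of_outer_approx; apply: (Se_outer _ (tfP _ blD)).
    exact: tfcv sbl.
  by apply: nearW => k; exact: tfP.
(* The nearest points to [q] in the nearby solution sets converge to the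
   projection of [q] onto the limit set, which is [q]. *)
move=> q Sq; exists (fun k => PSe q (tf (s k))); split.
  move=> k; have kP := tfP _ (sD k).
  by have [] := projP (nearest_exists q (Se_compact kP) (Se_neq0 kP)).
have qE : PSe q (tf bl) = q.
  have Sne := ex_intro _ q (nearest_self Sq).
  apply: nearest_unique (projP Sne) (nearest_self Sq) => p p'.
  exact: Se_midpoint (tfP _ blD).
rewrite -[X in _ --> X]qE; apply: (PSe_cvg _ (tfP _ blD)) => //.
  exact: tfcv sbl.
by apply: nearW => k; exact: tfP.
Qed.
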